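(* Let $\mathcal{A}$ be a Hopf algebra with invertible antipode over a field, let $P\in\mathcal{A}$ be a right group-like projection, $\mathcal{N}_P$ the associated left coideal subalgebra and $\mathcal{V}_P\subset\mathcal{N}_P$ the smallest left coideal containing $P$. Then $\mathcal{V}_P=\mathcal{N}_P$ if and only if $\mathcal{N}_P$ is quasi-Frobenius.
   Context: $(\mathcal{A},\Delta,S,\varepsilon)$ is a Hopf algebra over an arbitrary field with invertible antipode $S$ and unit $1$. A projection is an idempotent. A right group-like projection is a non-zero projection $P\in\mathcal{A}$ with $\Delta(P)(1\otimes P)=P\otimes P=(1\otimes P)\Delta(P)$. A left coideal is a subspace $\mathcal{V}\subset\mathcal{A}$ with $\Delta(\mathcal{V})\subset\mathcal{A}\otimes\mathcal{V}$; a left coideal subalgebra is a unital subalgebra that is a left coideal. Define $\mathcal{N}_P=\{x\in\mathcal{A}:\Delta(x)(1\otimes P)=(1\otimes P)\Delta(x)=x\otimes P\}$, a left coideal subalgebra (known to be finite-dimensional), and $\mathcal{V}_P=\{(\mu\otimes\mathrm{id})(\Delta(P)):\mu\in\mathcal{A}^*\}$. A finite-dimensional algebra is quasi-Frobenius if it is injective as a module over itself. *)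

(* Defs.v *)
From HB Require Import structures.
From mathcomp Require Import all_boot all_algebra.
From mathcomp Require Import boolp classical_sets.

Set Implicit Arguments.
Unset Strict Implicit.
Unset Printing Implicit Defensive.

Import GRing.Theory.
Local Open Scope ring_scope.
Local Open Scope quotient_scope.

(* The tensor product of two vector spaces, by generators and relations: the
   list [:: (v1, w1); ...; (vn, wn)] stands for v1 (x) w1 + ... + vn (x) wn.
   Scalars are absorbed in either factor, so no separate coefficients occur. *)
Section TensorSpace.
Variables (K : fieldType) (V W : lmodType K).
Implicit Types (v : V) (w : W) (s t : seq (V * W)).

Inductive teq : seq (V * W) -> seq (V * W) -> Prop :=
| teq_refl s : teq s s
| teq_sym s t : teq s t -> teq t s
| teq_trans s t u : teq s t -> teq t u -> teq s u
| teq_cat s s' t t' : teq s s' -> teq t t' -> teq (s ++ t) (s' ++ t')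
| teq_catC s t : teq (s ++ t) (t ++ s)
| teq_0 w : teq [:: (0, w)] [::]
| teq_Dl v v' w : teq [:: (v + v', w)] [:: (v, w); (v', w)]
| teq_Dr v w w' : teq [:: (v, w + w')] [:: (v, w); (v, w')]
| teq_Z a v w : teq [:: (a *: v, w)] [:: (v, a *: w)].

Definition teqb s t := `[< teq s t >].

Lemma teqb_refl : reflexive teqb.
Proof. by move=> s; apply/asboolP; exact: teq_refl. Qed.

Lemma teqb_sym : symmetric teqb.
Proof. by move=> s t; apply/asboolP/asboolP; exact: teq_sym. Qed.

Lemma teqb_trans : transitive teqb.
Proof.
by move=> t s u /asboolP st /asboolP tu; apply/asboolP; exact: teq_trans st tu.
Qed.

Canonical teqb_equiv := EquivRel teqb teqb_refl teqb_sym teqb_trans.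

Definition tensor := {eq_quot teqb}.
HB.instance Definition _ := Choice.on tensor.
HB.instance Definition _ := EqQuotient.on tensor.

Definition tens v w : tensor := \pi_tensor [:: (v, w)].

Lemma tensP s t : reflect (teq s t) (\pi_tensor s == \pi_tensor t).
Proof. by rewrite piE; exact: asboolP. Qed.

Lemma teq_repr s : teq (repr (\pi_tensor s)) s.
Proof. by apply/tensP; rewrite reprK. Qed.

Definition tadd (x y : tensor) : tensor := \pi_tensor (repr x ++ repr y).
Definition tscale (a : K) (x : tensor) : tensor :=
  \pi_tensor [seq (a *: p.1, p.2) | p <- repr x].

Lemma taddE s t : tadd (\pi s) (\pi t) = \pi_tensor (s ++ t).
Proof. by apply/eqP/tensP; apply: teq_cat; exact: teq_repr. Qed.

Lemma teq_scale (a : K) s t : teq s t ->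
  teq [seq (a *: p.1, p.2) | p <- s] [seq (a *: p.1, p.2) | p <- t].
Proof.
elim=> {s t} /=.
- by move=> s; exact: teq_refl.
- by move=> s t _; exact: teq_sym.
- by move=> s t u _ + _; exact: teq_trans.
- by move=> s s' t t' _ + _; rewrite !map_cat; exact: teq_cat.
- by move=> s t; rewrite !map_cat; exact: teq_catC.
- by move=> w; rewrite scaler0; exact: teq_0.
- by move=> v v' w; rewrite scalerDr; exact: teq_Dl.
- by move=> v w w'; exact: teq_Dr.
- by move=> b v w; rewrite scalerA mulrC -scalerA; exact: teq_Z.
Qed.

Lemma tscaleE a s :
  tscale a (\pi s) = \pi_tensor [seq (a *: p.1, p.2) | p <- s].
Proof. by apply/eqP/tensP; apply: teq_scale; exact: teq_repr. Qed.

Lemma tscale0 x : tscale 0 x = \pi_tensor [::].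
Proof.
elim/quotW: x => s; rewrite tscaleE; apply/eqP/tensP.
elim: s => [|[v w] s IHs] /=; first exact: teq_refl.
rewrite scale0r -[X in teq _ X]cats0 -cat1s -[X in teq _ X]cat0s.
by apply: teq_cat; [exact: teq_0 | rewrite cats0].
Qed.

Lemma teq_catCA s t u : teq (s ++ (t ++ u)) (t ++ (s ++ u)).
Proof.
by rewrite !catA; apply: teq_cat; [exact: teq_catC | exact: teq_refl].
Qed.

Lemma taddA : associative tadd.
Proof.
move=> x y z; elim/quotW: x => x; elim/quotW: y => y; elim/quotW: z => z.
by rewrite !taddE catA.
Qed.

Lemma taddC : commutative tadd.
Proof.
move=> x y; elim/quotW: x => x; elim/quotW: y => y; rewrite !taddE.
by apply/eqP/tensP; exact: teq_catC.
Qed.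

Lemma tadd0 : left_id (\pi_tensor [::]) tadd.
Proof. by move=> x; elim/quotW: x => x; rewrite taddE. Qed.

Lemma tscaleDl x : {morph tscale^~ x : a b / a + b >-> tadd a b}.
Proof.
move=> a b; elim/quotW: x => s; rewrite !tscaleE taddE; apply/eqP/tensP.
elim: s => [|[v w] s IHs] /=; first exact: teq_refl.
apply: (@teq_trans _ ([:: (a *: v, w)] ++ ([:: (b *: v, w)]
   ++ ([seq (a *: p.1, p.2) | p <- s] ++ [seq (b *: p.1, p.2) | p <- s])))).
  rewrite catA -cat1s; apply: teq_cat => //.
  by rewrite scalerDl; exact: teq_Dl.
exact: (teq_cat (teq_refl [:: (a *: v, w)])
  (teq_catCA [:: (b *: v, w)] _ _)).
Qed.

Lemma tscale1 : left_id 1 tscale.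
Proof.
move=> x; elim/quotW: x => s; rewrite tscaleE; congr (\pi_tensor _).
by rewrite -[RHS]map_id; apply: eq_map => -[v w] /=; rewrite scale1r.
Qed.

Lemma taddN : left_inverse (\pi_tensor [::]) (tscale (-1)) tadd.
Proof.
by move=> x; rewrite -[x in tadd _ x]tscale1 -tscaleDl addNr tscale0.
Qed.

HB.instance Definition _ := GRing.isZmodule.Build tensor taddA taddC tadd0 taddN.

Lemma tscaleA a b x : tscale a (tscale b x) = tscale (a * b) x.
Proof.
elim/quotW: x => s; rewrite !tscaleE -map_comp; congr (\pi_tensor _).
by apply: eq_map => p /=; rewrite scalerA.
Qed.

Lemma tscaleDr : right_distributive tscale +%R.
Proof.
move=> a x y; elim/quotW: x => x; elim/quotW: y => y.
rewrite -[X in tscale _ X]/(tadd _ _) -[RHS]/(tadd _ _).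
by rewrite taddE !tscaleE taddE map_cat.
Qed.

HB.instance Definition _ := GRing.Zmodule_isLmodule.Build K tensor
  tscaleA tscale1 tscaleDr tscaleDl.

Lemma tensDl v v' w : tens (v + v') w = tens v w + tens v' w.
Proof. by rewrite [RHS]taddE; apply/eqP/tensP; exact: teq_Dl. Qed.

Lemma tensDr v w w' : tens v (w + w') = tens v w + tens v w'.
Proof. by rewrite [RHS]taddE; apply/eqP/tensP; exact: teq_Dr. Qed.

Lemma tensZl a v w : tens (a *: v) w = a *: tens v w.
Proof. by rewrite [RHS]tscaleE. Qed.

Lemma tensZr a v w : tens v (a *: w) = a *: tens v w.
Proof. by rewrite -tensZl; apply/eqP/tensP; apply: teq_sym; exact: teq_Z. Qed.

Lemma pi_tensorE s : \pi_tensor s = \sum_(p <- s) tens p.1 p.2.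
Proof.
elim: s => [|[v w] s IHs]; first by rewrite big_nil.
by rewrite big_cons -IHs -cat1s [RHS]taddE.
Qed.

Lemma tensorP (x : tensor) : exists s, x = \sum_(p <- s) tens p.1 p.2.
Proof. by exists (repr x); rewrite -pi_tensorE reprK. Qed.

Lemma tensor_ind (Q : tensor -> Prop) :
  Q 0 -> (forall x y, Q x -> Q y -> Q (x + y)) -> (forall v w, Q (tens v w)) ->
  forall x, Q x.
Proof.
move=> Q0 QD Qt x; have [s ->] := tensorP x.
by elim/big_ind: _ => // p _; exact: Qt.
Qed.

Definition bilinear_map (U : lmodType K) (f : V -> W -> U) : Prop :=
  (forall w, linear (f^~ w)) /\ (forall v, linear (f v)).

(* The linear map induced by f; meaningful only if f is bilinear, see
   tlift_tens and tlift_linear. *)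
Definition tlift (U : lmodType K) (f : V -> W -> U) (x : tensor) : U :=
  \sum_(p <- repr x) f p.1 p.2.

Section Lift.
Variables (U : lmodType K) (f : V -> W -> U).
Hypothesis f_bil : bilinear_map f.

Lemma teq_lift s t : teq s t ->
  \sum_(p <- s) f p.1 p.2 = \sum_(p <- t) f p.1 p.2.
Proof.
have fDl w v v' : f (v + v') w = f v w + f v' w.
  by rewrite -[v in LHS]scale1r (f_bil.1 w) scale1r.
have fDr v w w' : f v (w + w') = f v w + f v w'.
  by rewrite -[w in LHS]scale1r (f_bil.2 v) scale1r.
have f0l w : f 0 w = 0 by apply: (addrI (f 0 w)); rewrite -fDl !addr0.
have f0r v : f v 0 = 0 by apply: (addrI (f v 0)); rewrite -fDr !addr0.
elim=> {s t}; do ?by move=> *; rewrite ?big_cat ?big_seq1 ?big_cons ?big_nil /=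
  ?addr0 ?fDl ?fDr ?f0l //.
- by move=> s t u _ -> _ ->.
- by move=> s s' t t' _ e _ e'; rewrite !big_cat /= e e'.
- by move=> s t; rewrite !big_cat /= addrC.
move=> a v w; rewrite !big_seq1 /= -[a *: v]addr0 (f_bil.1 w) f0l.
by rewrite -[a *: w]addr0 (f_bil.2 v) f0r.
Qed.

Lemma tlift_tens v w : tlift f (tens v w) = f v w.
Proof. by rewrite /tlift (teq_lift (teq_repr _)) big_seq1. Qed.

Lemma tlift_linear : linear (tlift f).
Proof.
move=> a x y; elim/quotW: x => s; elim/quotW: y => t.
rewrite [_ *: _]tscaleE [_ + _]taddE /tlift !(teq_lift (teq_repr _)).
rewrite big_cat /= big_map scaler_sumr; congr (_ + _); apply: eq_bigr => p _ /=.
have f0 : f 0 p.2 = 0 by rewrite -(subrr 0) -scaleN1r addrC (f_bil.1 p.2) scaleN1r addNr.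
by rewrite -[_ *: p.1]addr0 (f_bil.1 p.2) f0 addr0.
Qed.

End Lift.
End TensorSpace.

Arguments tensor [K] (V W)%_type_scope.

Notation "V ⊗ W" := (tensor V W) (at level 40, left associativity) : type_scope.
Notation "v ⊗ w" := (tens v w) (at level 40, left associativity) : ring_scope.

Section TensorMaps.
Variable K : fieldType.

Lemma tens_bilinear (V W : lmodType K) : bilinear_map (@tens K V W).
Proof.
by split=> [w a v v'|v a w w'] /=; rewrite ?(tensDl, tensDr, tensZl, tensZr).
Qed.

Definition tensor_map (V V' W W' : lmodType K) (f : V -> V') (g : W -> W') :
  V ⊗ W -> V' ⊗ W' := tlift (fun v w => f v ⊗ g w).

Definition tensor_assoc (U V W : lmodType K) :
  (U ⊗ V) ⊗ W -> U ⊗ (V ⊗ W) :=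
  tlift (fun x w => tlift (fun u v => u ⊗ (v ⊗ w)) x).

(* mu (x) id and id (x) mu, composed with K (x) W = W and V (x) K = V. *)
Definition slice_l (V W : lmodType K) (mu : V -> K) : V ⊗ W -> W :=
  tlift (fun v w => mu v *: w).

Definition slice_r (V W : lmodType K) (mu : W -> K) : V ⊗ W -> V :=
  tlift (fun v w => mu w *: v).

Definition tensor_mul (A : algType K) : A ⊗ A -> A := tlift *%R.

Lemma linear_for_tlift (V W U X : lmodType K) (F : X -> V -> W -> U) :
  (forall x, bilinear_map (F x)) ->
  (forall v w, linear (fun x => F x v w)) ->
  forall z, linear (fun x => tlift (F x) z).
Proof.
move=> F_bil F_lin z a x y; rewrite /tlift scaler_sumr -big_split.
by apply: eq_bigr => p _; exact: F_lin.
Qed.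

Section Rules.
Variables (U V V' W W' : lmodType K).

Lemma tensor_map_bilinear (f : {linear V -> V'}) (g : {linear W -> W'}) :
  bilinear_map (fun v w => f v ⊗ g w).
Proof.
by split=> [w a v v'|v a w w'] /=; rewrite linearP ?(tensDl, tensDr, tensZl, tensZr).
Qed.

Lemma tensor_mapE (f : {linear V -> V'}) (g : {linear W -> W'}) v w :
  tensor_map f g (v ⊗ w) = f v ⊗ g w.
Proof. exact: tlift_tens (tensor_map_bilinear f g) v w. Qed.

Lemma tensor_map_linear (f : {linear V -> V'}) (g : {linear W -> W'}) :
  linear (tensor_map f g).
Proof. exact: tlift_linear (tensor_map_bilinear f g). Qed.

Lemma slice_l_bilinear (mu : {scalar V}) :
  bilinear_map (fun (v : V) (w : W) => mu v *: w).
Proof.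
split=> [w a v v'|v a w w'] /=; first by rewrite linearP scalerDl scalerA.
by rewrite scalerDr !scalerA mulrC.
Qed.

Lemma slice_lE (mu : {scalar V}) (v : V) (w : W) :
  slice_l mu (v ⊗ w) = mu v *: w.
Proof. exact: tlift_tens (slice_l_bilinear mu) v w. Qed.

Lemma slice_l_linear (mu : {scalar V}) : linear (@slice_l V W mu).
Proof. exact: tlift_linear (slice_l_bilinear mu). Qed.

Lemma slice_r_bilinear (mu : {scalar W}) :
  bilinear_map (fun (v : V) (w : W) => mu w *: v).
Proof.
split=> [w a v v'|v a w w'] /=; last by rewrite linearP scalerDl scalerA.
by rewrite scalerDr !scalerA mulrC.
Qed.

Lemma slice_rE (mu : {scalar W}) (v : V) (w : W) :
  slice_r mu (v ⊗ w) = mu w *: v.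
Proof. exact: tlift_tens (slice_r_bilinear mu) v w. Qed.

Lemma slice_r_linear (mu : {scalar W}) : linear (@slice_r V W mu).
Proof. exact: tlift_linear (slice_r_bilinear mu). Qed.

Lemma tensor_assoc_bilinear1 (w : W) :
  bilinear_map (fun (u : U) (v : V) => u ⊗ (v ⊗ w)).
Proof.
by split=> [v a u u'|u a v v'] /=; rewrite ?(tensDl, tensDr, tensZl, tensZr).
Qed.

Lemma tensor_assoc_bilinear :
  bilinear_map (fun (x : U ⊗ V) (w : W) => tlift (fun u v => u ⊗ (v ⊗ w)) x).
Proof.
split=> [w|x]; first exact: tlift_linear (tensor_assoc_bilinear1 w).
apply: (@linear_for_tlift U V _ W (fun w u v => u ⊗ (v ⊗ w))).
  exact: tensor_assoc_bilinear1.
by move=> u v a w w' /=; rewrite ?(tensDr, tensZr).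
Qed.

Lemma tensor_assocE (u : U) (v : V) (w : W) :
  tensor_assoc ((u ⊗ v) ⊗ w) = u ⊗ (v ⊗ w).
Proof.
rewrite /tensor_assoc (tlift_tens tensor_assoc_bilinear).
exact: tlift_tens (tensor_assoc_bilinear1 w) u v.
Qed.

Lemma tensor_assoc_linear : linear (@tensor_assoc U V W).
Proof. exact: tlift_linear tensor_assoc_bilinear. Qed.

Lemma tensor_mul_bilinear (A : algType K) : bilinear_map ( *%R : A -> A -> A).
Proof.
split=> [w a v v'|v a w w'] /=; first by rewrite mulrDl scalerAl.
by rewrite mulrDr scalerAr.
Qed.

Lemma tensor_mulE (A : algType K) (a b : A) : tensor_mul (a ⊗ b) = a * b.
Proof. exact: tlift_tens (tensor_mul_bilinear A) a b. Qed.

Lemma tensor_mul_linear (A : algType K) : linear (@tensor_mul A).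
Proof. exact: tlift_linear (tensor_mul_bilinear A). Qed.

End Rules.
End TensorMaps.

Section TensorRing.
Variables (K : fieldType) (A B : algType K).
Implicit Types (a c : A) (b d : B) (x y z : A ⊗ B).

(* The product determined by (a (x) b) (c (x) d) = ac (x) bd. *)
Definition tprod x y : A ⊗ B :=
  tlift (fun a b => tlift (fun c d => (a * c) ⊗ (b * d)) y) x.

Lemma tprod_bilinear1 a b :
  bilinear_map (fun (c : A) (d : B) => (a * c) ⊗ (b * d)).
Proof.
split=> [d k c c'|c k d d'] /=.
  by rewrite mulrDr -scalerAr tensDl tensZl.
by rewrite mulrDr -scalerAr tensDr tensZr.
Qed.

Lemma tprod_bilinear2 y :
  bilinear_map (fun a b => tlift (fun c d => (a * c) ⊗ (b * d)) y).
Proof.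
split=> [b|a].
  apply: (@linear_for_tlift K A B _ A (fun a c d => (a * c) ⊗ (b * d))).
    by move=> a; exact: tprod_bilinear1.
  by move=> c d k a a' /=; rewrite mulrDl -scalerAl tensDl tensZl.
apply: (@linear_for_tlift K A B _ B (fun b c d => (a * c) ⊗ (b * d))).
  by move=> b; exact: tprod_bilinear1.
by move=> c d k b b' /=; rewrite mulrDl -scalerAl tensDr tensZr.
Qed.

Lemma tprodE a b c d : tprod (a ⊗ b) (c ⊗ d) = (a * c) ⊗ (b * d).
Proof.
rewrite /tprod (tlift_tens (tprod_bilinear2 _)).
exact: tlift_tens (tprod_bilinear1 a b) c d.
Qed.

Lemma tprod_linear_l y : linear (tprod^~ y).
Proof. exact: tlift_linear (tprod_bilinear2 y). Qed.

Lemma tprod_linear_r x : linear (tprod x).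
Proof.
move=> k y z; rewrite /tprod /tlift scaler_sumr -big_split /=.
by apply: eq_bigr => p _; exact: (tlift_linear (tprod_bilinear1 _ _)).
Qed.

Lemma tprodDl : left_distributive tprod +%R.
Proof. by move=> x y z; have := tprod_linear_l z 1 x y; rewrite !scale1r. Qed.

Lemma tprodDr : right_distributive tprod +%R.
Proof. by move=> x y z; have := tprod_linear_r x 1 y z; rewrite !scale1r. Qed.

Lemma tprod0 x : tprod x 0 = 0.
Proof. by apply: (addrI (tprod x 0)); rewrite -tprodDr !addr0. Qed.

Lemma t0prod x : tprod 0 x = 0.
Proof. by apply: (addrI (tprod 0 x)); rewrite -tprodDl !addr0. Qed.

Lemma tprodA : associative tprod.
Proof.
move=> x y z; elim/tensor_ind: x => [|x x' IH IH'|a b].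
- by rewrite !t0prod.
- by rewrite !tprodDl IH IH'.
elim/tensor_ind: y => [|y y' IH IH'|c d].
- by rewrite !(t0prod, tprod0).
- by rewrite !(tprodDl, tprodDr) IH IH'.
elim/tensor_ind: z => [|z z' IH IH'|e f].
- by rewrite !tprod0.
- by rewrite !tprodDr IH IH'.
by rewrite !tprodE !mulrA.
Qed.

Lemma t1prod : left_id (1 ⊗ 1) tprod.
Proof.
elim/tensor_ind=> [|x y IH IH'|a b]; rewrite ?tprod0 ?tprodDr ?IH ?IH' //.
by rewrite tprodE !mul1r.
Qed.

Lemma tprod1 : right_id (1 ⊗ 1) tprod.
Proof.
elim/tensor_ind=> [|x y IH IH'|a b]; rewrite ?t0prod ?tprodDl ?IH ?IH' //.
by rewrite tprodE !mulr1.
Qed.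

HB.instance Definition _ := GRing.Zmodule_isPzRing.Build (A ⊗ B)%type
  tprodA t1prod tprod1 tprodDl tprodDr.

Lemma tensM a b c d : (a ⊗ b) * (c ⊗ d) = (a * c) ⊗ (b * d).
Proof. exact: tprodE. Qed.

Lemma tens1 : (1 : A) ⊗ (1 : B) = 1.
Proof. by []. Qed.

Lemma tensor_scalerAl (k : K) x y : k *: (x * y) = (k *: x) * y.
Proof.
have := tprod_linear_l y k x 0.
by rewrite /= t0prod !addr0 => /esym.
Qed.

Lemma tensor_scalerAr (k : K) x y : k *: (x * y) = x * (k *: y).
Proof.
have := tprod_linear_r x k y 0.
by rewrite /= tprod0 !addr0 => /esym.
Qed.

End TensorRing.

HB.mixin Record Algebra_isHopf (K : fieldType) A of GRing.Algebra K A := {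
  comul : {lrmorphism A -> A ⊗ A | *:%R};
  counit : {lrmorphism A -> K | *%R};
  antipode : {linear A -> A};
  comulA : forall x : A,
    tensor_assoc (tensor_map comul idfun (comul x))
      = tensor_map idfun comul (comul x);
  counit_l : forall x : A, slice_l counit (comul x) = x;
  counit_r : forall x : A, slice_r counit (comul x) = x;
  antipode_l : forall x : A,
    tensor_mul (tensor_map antipode idfun (comul x)) = counit x *: 1;
  antipode_r : forall x : A,
    tensor_mul (tensor_map idfun antipode (comul x)) = counit x *: 1
}.

#[short(type="hopfAlgType")]
HB.structure Definition HopfAlgebra (K : fieldType) :=
  {A of GRing.Algebra K A & Algebra_isHopf K A}.

Section GroupLikeProjection.
Variables (K : fieldType) (A : hopfAlgType K).
Implicit Types P x : A.
Local Notation Δ := (comul : A -> A ⊗ A).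

Definition right_group_like_projection P : Prop :=
  [/\ P != 0, P * P = P,
      Δ P * (1 ⊗ P) = P ⊗ P & (1 ⊗ P) * Δ P = P ⊗ P].

Definition NP P : set A :=
  [set x | Δ x * (1 ⊗ P) = x ⊗ P /\ (1 ⊗ P) * Δ x = x ⊗ P].

Definition VP P : set A :=
  [set x | exists mu : {scalar A}, x = slice_l mu (Δ P)].

(* NP P is a unital subalgebra, for every P. *)
Definition NP_pred P : {pred A} := [pred x | x \in NP P].

Lemma NP_predP P x :
  reflect (Δ x * (1 ⊗ P) = x ⊗ P /\ (1 ⊗ P) * Δ x = x ⊗ P) (x \in NP_pred P).
Proof. by rewrite inE; apply: (iffP idP) => [/set_mem|/mem_set]. Qed.

Lemma NP_subalg P : GRing.subsemialg_closed (NP_pred P).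
Proof.
have N1 : 1 \in NP_pred P.
  by apply/NP_predP; rewrite rmorph1 mul1r mulr1.
have ND : {in NP_pred P &, forall x y, x + y \in NP_pred P}.
  move=> x y /NP_predP[x1 x2] /NP_predP[y1 y2]; apply/NP_predP.
  by rewrite raddfD mulrDl mulrDr x1 x2 y1 y2 tensDl.
have NZ k : {in NP_pred P, forall x, k *: x \in NP_pred P}.
  move=> x /NP_predP[x1 x2]; apply/NP_predP.
  by rewrite linearZ /= -tensor_scalerAl -tensor_scalerAr x1 x2 tensZl.
have NM : {in NP_pred P &, forall x y, x * y \in NP_pred P}.
  move=> x y /NP_predP[x1 x2] /NP_predP[y1 y2]; apply/NP_predP.
  have comm (z : A) : (1 ⊗ P) * (z ⊗ 1) = z ⊗ P by rewrite tensM !(mul1r, mulr1).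
  have comm' (z : A) : (z ⊗ 1) * (1 ⊗ P) = z ⊗ P by rewrite tensM !(mul1r, mulr1).
  rewrite rmorphM; split.
    by rewrite -mulrA y1 -comm mulrA x1 tensM mulr1.
  by rewrite mulrA x2 -comm' -mulrA y2 tensM mul1r.
have N0 : 0 \in NP_pred P by rewrite -(scale0r 1) NZ.
by split=> //; do ?split.
Qed.

HB.instance Definition _ P :=
  GRing.isSubalgClosed.Build K A (NP_pred P) (NP_subalg P).

Record NP_alg P := NPAlg {NP_val :> A; _ : NP_val \in NP_pred P}.

HB.instance Definition _ P := [isSub for @NP_val P].
HB.instance Definition _ P := [Choice of NP_alg P by <:].
HB.instance Definition _ P := [SubChoice_isSubAlgebra of NP_alg P by <:].

End GroupLikeProjection.

Definition injective_module (R : nzRingType) (M : lmodType R) : Prop :=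
  forall (X Y : lmodType R) (i : {linear X -> Y}) (f : {linear X -> M}),
    injective i -> exists g : {linear Y -> M}, forall x, g (i x) = f x.

Definition finite_dimensional (K : fieldType) (V : lmodType K) : Prop :=
  exists n, inhabited (Vector.axiom n V).

(* lmodType is the type of left modules, so B is tested as a left module over
   itself; for finite-dimensional B this agrees with right self-injectivity. *)
Definition quasi_frobenius (K : fieldType) (B : algType K) : Prop :=
  finite_dimensional B /\ injective_module (GRing.regular B).

(* Main.v *)
Require Import Defs.
From HB Require Import structures.
From mathcomp Require Import all_boot all_algebra.
From mathcomp Require Import boolp classical_sets.

Set Implicit Arguments.
Unset Strict Implicit.
Unset Printing Implicit Defensive.

Import GRing.Theory.
Local Open Scope ring_scope.

(** Write N for [NP P], V for [VP P], S for the antipode and P1 ⊗ P2 for Δ(P).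
    Multiplying out the two defining equations of N gives, for x in N,

      (1 ⊗ x) Δ(P) = (S(x) ⊗ 1) Δ(P),   Δ(P) (1 ⊗ x) = Δ(P) (S^-1(x) ⊗ 1),

    so V is a two-sided ideal of N, and everything turns on whether V contains 1.

    If V = N, pick a functional mu with 1 = mu(P1) P2. The functionals on A
    form a left N-module by x.m = m(S(x) _), and m |-> m(P1) P2 is an N-linear
    surjection onto N which is split by x |-> x.mu. The dual of A is injective:
    a K-linear extension of an N-linear map is made N-linear by averaging it
    over P, which works because the counit of P is 1. So its direct summand N
    is injective as well ([VP_NP_injective]). Finite dimension comes from
    N = V being spanned by the right legs of Δ(P).

    Conversely, suppose N is finite-dimensional and left self-injective. The
    right ideal V has zero left annihilator: if y in N kills V, then
    (1 ⊗ y) Δ(P) = 0, and inverting the comultiplication turns this into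
    y ⊗ P = Δ(y)(1 ⊗ P) = 0 ([NP_left_faithful]). In a finite-dimensional left
    self-injective algebra B a right ideal with zero left annihilator is
    everything ([self_injective_right_ideal]): B is a direct summand of copies
    of its dual as a left module, so dually the right module of functionals on B
    embeds in a free one; a functional that vanishes on the ideal is killed by it
    there, hence is zero.

    Modules over N are arbitrary, so complements of subspaces are needed in
    infinite dimension; they come from Zorn's lemma ([subspace_projection]).
    Elements of a tensor product are handled through expressions
    sum_i a_i ⊗ b_i of minimal length, whose two families are then linearly
    independent ([tensor_biorthogonal]). *)

(** * Complements, dual families and tensors of minimal length *)

Section LinearAlgebra.
Variable K : fieldType.

Section Lin.
Variables (R : nzRingType) (U V : lmodType R) (f : U -> V).
Hypothesis f_lin : linear f.

(** Maps such as [tlift f] come with a proof that they are linear and not with a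
    canonical structure; this lets the generic lemmas apply to them. *)
Definition lin_of : {linear U -> V} := HB.pack f (GRing.isLinear.Build _ _ _ _ f f_lin).

Lemma lin_sum I (r : seq I) (F : I -> U) :
  f (\sum_(i <- r) F i) = \sum_(i <- r) f (F i).
Proof. exact: (linear_sum lin_of). Qed.

Lemma linD u v : f (u + v) = f u + f v.
Proof. exact: (linearD lin_of). Qed.

Lemma lin0 : f 0 = 0.
Proof. exact: (linear0 lin_of). Qed.

Lemma linB u v : f (u - v) = f u - f v.
Proof. exact: (linearB lin_of). Qed.

Lemma linZ k u : f (k *: u) = k *: f u.
Proof. exact: (linearZ_LR lin_of). Qed.

End Lin.

Definition scalar_of (U : lmodType K) (f : U -> K) (f_lin : scalar f) : {scalar U} :=
  HB.pack f (GRing.isLinear.Build _ _ _ _ f f_lin).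

Definition subspace (Y : lmodType K) (U : set Y) : Prop :=
  U 0 /\ forall a x y, U x -> U y -> U (a *: x + y).

(** The projection along a complement, which Zorn's lemma provides in any
    dimension. *)
Lemma subspace_projection (Y : lmodType K) (V : set Y) : subspace V ->
  exists p : {linear Y -> Y}, (forall y, V (p y)) /\ (forall v, V v -> p v = v).
Proof.
move=> [V0 VP].
have VB x y : V x -> V y -> V (x - y).
  by move=> Vx Vy; rewrite addrC -scaleN1r; exact: VP.
(* A maximal U that meets V in 0 is a complement of V. Q does not ask that U
   contain 0, because the union of the empty chain is empty; maximality gives it. *)
pose Q (U : set Y) := (forall a x y, U x -> U y -> U (a *: x + y)) /\
   (forall x, U x -> V x -> x = 0).
have [|U [[UP UV] Umax]] := @Zorn_bigcup Y Q.
  move=> F FQ Ftot; split.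
    move=> a x y [B FB Bx] [C FC Cy].
    have [BC|CB] := Ftot _ _ FB FC.
      by exists C => //; apply: (FQ _ FC).1 => //; exact: BC.
    by exists B => //; apply: (FQ _ FB).1 => //; exact: CB.
  by move=> x [B FB Bx]; exact: (FQ _ FB).2.
have U0 : U 0.
  apply: contrapT => nU0; apply: (Umax (fun x => U x \/ x = 0)).
    split; last by move=> sub; apply: nU0; apply: sub; right.
    by move=> x Ux; left.
  split; last by move=> x [Ux|->] //; exact: UV.
  move=> a x y [Ux|->] [Uy|->].
  - by left; exact: UP.
  - left; have := UP (a - 1) x x Ux Ux.
    by rewrite scalerBl scale1r subrK addr0.
  - by left; rewrite scaler0 add0r.
  - by right; rewrite scaler0 addr0.
have UB x y : U x -> U y -> U (x - y).
  by move=> Ux Uy; rewrite addrC -scaleN1r; exact: UP.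
have dec y : exists v, V v /\ U (y - v).
  apply: contrapT => nex.
  apply: (Umax (fun x => exists k u, U u /\ x = k *: y + u)).
    split; first by move=> u Uu; exists 0, u; rewrite scale0r add0r.
    move=> sub; apply: nex; exists 0; split=> //; rewrite subr0; apply: sub.
    by exists 1, 0; rewrite scale1r addr0.
  split.
    move=> a _ _ [k [u [Uu ->]]] [l [w [Uw ->]]].
    exists (a * k + l), (a *: u + w); split; first exact: UP.
    by rewrite scalerDl scalerDr !scalerA addrACA.
  move=> _ [k [u [Uu ->]]] Vx.
  have [k0|k0] := eqVneq k 0; first by move: Vx; rewrite k0 scale0r add0r; exact: UV.
  case: nex; exists (k^-1 *: (k *: y + u)); split.
    by rewrite -[X in V X]addr0; exact: VP.
  rewrite scalerDr scalerA mulVf // scale1r opprD addrA subrr add0r -scaleNr.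
  by rewrite -[X in U X]addr0; exact: UP.
pose p y := projT1 (cid (dec y)).
have pP y : V (p y) /\ U (y - p y) := projT2 (cid (dec y)).
have puniq y v : V v -> U (y - v) -> p y = v.
  move=> Vv Uv; have [Vp Up] := pP y; apply/eqP; rewrite -subr_eq0; apply/eqP.
  apply: UV; last exact: VB.
  by have := UB _ _ Uv Up; rewrite opprB addrC addrA subrK.
have p_lin : linear p.
  move=> a x y; apply: puniq; first by apply: VP; exact: (pP _).1.
  have := UP a _ _ (pP x).2 (pP y).2.
  by rewrite scalerBr opprD addrACA.
exists (lin_of p_lin); split=> [y|v Vv]; first exact: (pP y).1.
by apply: puniq => //; rewrite subrr.
Qed.

Lemma linear_retraction (X Y : lmodType K) (i : {linear X -> Y}) : injective i ->
  exists r : {linear Y -> X}, cancel i r.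
Proof.
move=> i_inj; pose V : set Y := fun y => exists x, y = i x.
have [|p [pV pE]] := @subspace_projection Y V.
  split; first by exists 0; rewrite linear0.
  by move=> a _ _ [x ->] [y ->]; exists (a *: x + y); rewrite linearP.
pose r y := projT1 (cid (pV y)).
have rP y : p y = i (r y) := projT2 (cid (pV y)).
have r_lin : linear r.
  by move=> a x y; apply: i_inj; rewrite linearP -!rP linearP.
exists (lin_of r_lin) => x; apply: i_inj; rewrite /= -rP.
by apply: pE; exists x.
Qed.

Section Families.
Variables (V : lmodType K) (n : nat) (a : 'I_n -> V).

Definition free_family := forall c : 'I_n -> K, \sum_i c i *: a i = 0 -> forall i, c i = 0.

(** The coordinates with respect to the family, extended to V by a retraction
    of the embedding of the row space that the family defines. *)
Lemma dual_functionals : free_family ->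
  exists mu : 'I_n -> {scalar V}, forall i j, mu i (a j) = (i == j)%:R.
Proof.
move=> fr; pose f (u : 'rV[K]_n) := \sum_i u 0 i *: a i.
have f_lin : linear f.
  move=> k u v; rewrite /f scaler_sumr -big_split; apply: eq_bigr => i _ /=.
  by rewrite !mxE scalerDl scalerA.
have [|r rK] := @linear_retraction _ _ (lin_of f_lin).
  move=> u v /= /eqP; rewrite -subr_eq0 => /eqP e.
  apply/rowP => i; apply/eqP; rewrite -subr_eq0; apply/eqP.
  apply: (fr (fun i => u 0 i - v 0 i)); rewrite -[RHS]e /f -sumrB.
  by apply: eq_bigr => j _; rewrite scalerBl.
have mu_lin i : scalar (fun v => r v 0 i).
  by move=> k u v; rewrite /= linearP !mxE.
exists (fun i => scalar_of (mu_lin i)) => i j /=.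
have -> : a j = lin_of f_lin (delta_mx 0 j).
  rewrite /= /f (bigD1 j) //= big1 ?mxE ?eqxx ?scale1r ?addr0 //.
  by move=> k kj; rewrite mxE (negPf kj) andbF scale0r.
by rewrite rK mxE eqxx.
Qed.

End Families.

(** Solving a linear relation for one of the a_i and distributing makes the sum
    shorter by one term. It is stated for any bilinear f so that exchanging the
    two legs of a tensor gives the same reduction for relations among the b_i. *)
Lemma bilinear_sum_reduce (V W U : lmodType K) (f : V -> W -> U) n
    (a : 'I_n.+1 -> V) (b : 'I_n.+1 -> W) :
  bilinear_map f -> ~ free_family a ->
  exists (a' : 'I_n -> V) (b' : 'I_n -> W),
    \sum_i f (a i) (b i) = \sum_i f (a' i) (b' i).
Proof.
move=> [fl fr] /existsNP[c /not_implyP[c0 /existsNP[k /eqP ck]]].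
exists (fun i => a (lift k i)), (fun i => b (lift k i) - (c (lift k i) / c k) *: b k).
have ak : a k = \sum_i (- (c (lift k i) / c k)) *: a (lift k i).
  move: c0; rewrite (bigD1_ord k) //= => /(congr1 (fun x => (c k)^-1 *: x)).
  rewrite scaler0 scalerDr scalerA mulVf // scale1r => /eqP.
  rewrite addr_eq0 => /eqP ->; rewrite scaler_sumr -sumrN; apply: eq_bigr => i _.
  by rewrite scalerA -scaleNr mulrC.
rewrite (bigD1_ord k) //= {1}ak (lin_sum (fl (b k))) -big_split.
apply: eq_bigr => i _ /=.
by rewrite (linZ (fl (b k))) addrC (linB (fr _)) (linZ (fr _)) scaleNr.
Qed.

(** In an expression of t of minimal length both families are free, as otherwise
    [bilinear_sum_reduce] would shorten it. *)
Lemma tensor_biorthogonal (V W : lmodType K) (t : V ⊗ W) :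
  exists n (a : 'I_n -> V) (b : 'I_n -> W)
    (mu : 'I_n -> {scalar V}) (nu : 'I_n -> {scalar W}),
  [/\ t = \sum_i a i ⊗ b i, forall i j, mu i (a j) = (i == j)%:R
    & forall i j, nu i (b j) = (i == j)%:R].
Proof.
pose rank n := `[< exists (a : 'I_n -> V) (b : 'I_n -> W), t = \sum_i a i ⊗ b i >].
have ex : exists n, rank n.
  have [s tE] := tensorP t; exists (size s); apply/asboolP; rewrite tE.
  exists (fun i => (nth (0, 0) s i).1), (fun i => (nth (0, 0) s i).2).
  by rewrite (big_nth (0, 0)) big_mkord.
case: (ex_minnP ex) => n /asboolP[a [b tE]] n_min.
have short m : n = m.+1 -> forall (a' : 'I_m -> V) (b' : 'I_m -> W), t <> \sum_i a' i ⊗ b' i.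
  move=> nm a' b' e; have : (n <= m)%N by apply: n_min; apply/asboolP; exists a', b'.
  by rewrite nm ltnn.
have a_free : free_family a.
  case: n a b tE {n_min} short => [a b _ _ c _ [] //|n a b tE short].
  apply: contrapT => /(bilinear_sum_reduce b (tens_bilinear V W))[a' [b' e]].
  by apply: (short n erefl a' b'); rewrite tE.
have b_free : free_family b.
  case: n a b tE {n_min a_free} short => [a b _ _ c _ [] //|n a b tE short].
  have bil : bilinear_map (fun (w : W) (v : V) => v ⊗ w).
    by split=> [v|w]; [exact: (tens_bilinear V W).2|exact: (tens_bilinear V W).1].
  apply: contrapT => /(bilinear_sum_reduce a bil)[b' [a' e]].
  by apply: (short n erefl a' b'); rewrite tE.
have [mu muP] := dual_functionals a_free; have [nu nuP] := dual_functionals b_free.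
by exists n, a, b, mu, nu.
Qed.

End LinearAlgebra.

(** * Sweedler sums *)

Ltac multilinear := repeat (intro || split); rewrite /=;
  by rewrite ?(mulrDl, mulrDr, linearD, linearZ_LR, =^~ scalerAl, =^~ scalerAr,
     tensDl, tensDr, tensZl, tensZr).

Section Sweedler.
Variables (K : fieldType) (A : hopfAlgType K).
Implicit Types x y : A.
Local Notation Δ := (comul : A -> A ⊗ A).
Local Notation S := (antipode : A -> A).
Local Notation ε := (counit : A -> K).

Definition sweedler x : seq (A * A) := repr (Δ x).

Lemma comulE x : Δ x = \sum_(p <- sweedler x) p.1 ⊗ p.2.
Proof. by rewrite -pi_tensorE reprK. Qed.

Lemma tens_suml (V W : lmodType K) I (r : seq I) (F : I -> V) (w : W) :
  (\sum_(i <- r) F i) ⊗ w = \sum_(i <- r) F i ⊗ w.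
Proof. exact: (lin_sum ((tens_bilinear V W).1 w)). Qed.

Lemma tens_sumr (V W : lmodType K) I (r : seq I) (v : V) (F : I -> W) :
  v ⊗ (\sum_(i <- r) F i) = \sum_(i <- r) v ⊗ F i.
Proof. exact: (lin_sum ((tens_bilinear V W).2 v)). Qed.

(** A Sweedler sum of a bilinear expression does not depend on the chosen way to
    write Δ(x) as a sum of pure tensors. *)
Lemma sum_sweedlerE (U : lmodType K) (f : A -> A -> U) (f_bil : bilinear_map f) x
    I (r : seq I) a b :
  Δ x = \sum_(i <- r) a i ⊗ b i ->
  \sum_(p <- sweedler x) f p.1 p.2 = \sum_(i <- r) f (a i) (b i).
Proof.
move=> e; rewrite -[LHS]/(tlift f (Δ x)) e (lin_sum (tlift_linear f_bil)).
by apply: eq_bigr => i _; exact: tlift_tens.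
Qed.

Definition trilinear_map (U : lmodType K) (f : A -> A -> A -> U) :=
  (forall b c, linear (fun a => f a b c)) /\ (forall a, bilinear_map (f a)).

Lemma coassoc_sum (U : lmodType K) (f : A -> A -> A -> U) x : trilinear_map f ->
  \sum_(p <- sweedler x) \sum_(q <- sweedler p.1) f q.1 q.2 p.2 =
  \sum_(p <- sweedler x) \sum_(q <- sweedler p.2) f p.1 q.1 q.2.
Proof.
move=> [f1 f2]; pose F (a : A) (z : A ⊗ A) := tlift (f a) z.
have F_bil : bilinear_map F.
  split=> [z|a]; last exact: tlift_linear.
  exact: (linear_for_tlift f2 (fun v w => f1 v w)).
have FE a b c : tlift F (a ⊗ (b ⊗ c)) = f a b c.
  by rewrite (tlift_tens F_bil) /F (tlift_tens (f2 a)).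
have := congr1 (tlift F) (comulA x).
rewrite comulE !(lin_sum (tensor_map_linear _ _)) (lin_sum (@tensor_assoc_linear _ _ _ _)).
rewrite !(lin_sum (tlift_linear F_bil)).
move=> e; etransitivity; last (etransitivity; first exact: e).
  apply: eq_bigr => p _; rewrite tensor_mapE /= comulE tens_suml.
  rewrite (lin_sum (@tensor_assoc_linear _ _ _ _)) (lin_sum (tlift_linear F_bil)).
  by apply: eq_bigr => q _; rewrite tensor_assocE FE.
apply: eq_bigr => p _; rewrite tensor_mapE /= comulE tens_sumr.
by rewrite (lin_sum (tlift_linear F_bil)); apply: eq_bigr => q _; rewrite FE.
Qed.

Lemma sum_counit_l x : \sum_(p <- sweedler x) ε p.1 *: p.2 = x.
Proof.
rewrite -[RHS](counit_l x) comulE (lin_sum (slice_l_linear _)).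
by apply: eq_bigr => p _; rewrite slice_lE.
Qed.

Lemma sum_counit_r x : \sum_(p <- sweedler x) ε p.2 *: p.1 = x.
Proof.
rewrite -[RHS](counit_r x) comulE (lin_sum (slice_r_linear _)).
by apply: eq_bigr => p _; rewrite slice_rE.
Qed.

Lemma sum_antipode_l x : \sum_(p <- sweedler x) S p.1 * p.2 = ε x *: 1.
Proof.
rewrite -(antipode_l x) comulE (lin_sum (tensor_map_linear _ _)).
rewrite (lin_sum (@tensor_mul_linear _ _)).
by apply: eq_bigr => p _; rewrite tensor_mapE tensor_mulE.
Qed.

Lemma sum_antipode_r x : \sum_(p <- sweedler x) p.1 * S p.2 = ε x *: 1.
Proof.
rewrite -(antipode_r x) comulE (lin_sum (tensor_map_linear _ _)).
rewrite (lin_sum (@tensor_mul_linear _ _)).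
by apply: eq_bigr => p _; rewrite tensor_mapE tensor_mulE.
Qed.

Lemma antipode1 : S 1 = 1.
Proof.
have bil : bilinear_map (fun a b : A => S a * b).
  split=> [b|a] k u v /=; first by rewrite linearP mulrDl scalerAl.
  by rewrite mulrDr scalerAr.
have := sum_antipode_l 1.
rewrite (sum_sweedlerE bil (r := [:: tt]) (a := fun=> 1) (b := fun=> 1)).
  by rewrite big_seq1 mulr1 rmorph1 scale1r.
by rewrite big_seq1 rmorph1.
Qed.

Lemma comulM x y : Δ (x * y) = Δ x * Δ y.
Proof. exact: rmorphM. Qed.

(** S o m is left inverse to the multiplication m in the convolution algebra of
    maps from A ⊗ A to A. *)
Lemma sum_antipode_lM x y :
  \sum_(p <- sweedler x) \sum_(q <- sweedler y) S (p.1 * q.1) * (p.2 * q.2)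
    = (ε x * ε y) *: 1.
Proof.
have bil : bilinear_map (fun a b : A => S a * b) by multilinear.
have := sum_antipode_l (x * y); rewrite rmorphM => <-.
rewrite (sum_sweedlerE bil (r := [seq (p, q) | p <- sweedler x, q <- sweedler y])
  (a := fun r => r.1.1 * r.2.1) (b := fun r => r.1.2 * r.2.2)).
  by rewrite big_allpairs_dep.
rewrite comulM big_allpairs_dep [Δ x]comulE [Δ y]comulE mulr_suml; apply: eq_bigr => p _.
by rewrite mulr_sumr; apply: eq_bigr => q _; rewrite tensM.
Qed.

(** Both sides are convolution inverses of the multiplication: evaluating
    S(x1 y1) x2 y2 S(y3) S(x3) from the right gives S(xy), from the left
    S(y) S(x). *)
Lemma antipodeM x y : S (x * y) = S y * S x.
Proof.
have stepy a b c : \sum_(q <- sweedler y) \sum_(q' <- sweedler q.1)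
    S (a * q'.1) * (b * q'.2) * (S q.2 * S c) = S (a * y) * b * S c.
  rewrite (@coassoc_sum _ (fun u v w => S (a * u) * (b * v) * (S w * S c))); last first.
    by multilinear.
  rewrite -[y in RHS]sum_counit_r mulr_sumr linear_sum !mulr_suml.
  apply: eq_bigr => q _; rewrite -scalerAr linearZ /= -!scalerAl.
  transitivity (S (a * q.1) * b * (\sum_(q' <- sweedler q.2) q'.1 * S q'.2) * S c).
    rewrite mulr_sumr mulr_suml; apply: eq_bigr => q' _; by rewrite !mulrA.
  by rewrite sum_antipode_r -scalerAr mulr1 -scalerAl.
have stepx : \sum_(p <- sweedler x) \sum_(p' <- sweedler p.1)
    S (p'.1 * y) * p'.2 * S p.2 = S (x * y).
  rewrite (@coassoc_sum _ (fun u v w => S (u * y) * v * S w)); last by multilinear.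
  rewrite -[x in RHS]sum_counit_r mulr_suml linear_sum.
  apply: eq_bigr => p _; rewrite -scalerAl linearZ /=.
  rewrite -[S (p.1 * y) in RHS]mulr1 scalerAr -sum_antipode_r mulr_sumr.
  by apply: eq_bigr => p' _; rewrite !mulrA.
rewrite -stepx -[x in RHS]sum_counit_l -[y in RHS]sum_counit_l !linear_sum mulr_sumr.
apply: eq_bigr => p _; under eq_bigr do rewrite -stepy.
rewrite exchange_big mulr_suml; apply: eq_bigr => q _ /=.
transitivity ((\sum_(p' <- sweedler p.1) \sum_(q' <- sweedler q.1) S (p'.1 * q'.1) * (p'.2 * q'.2))
   * (S q.2 * S p.2)).
  by rewrite mulr_suml; apply: eq_bigr => p' _; rewrite mulr_suml.
rewrite sum_antipode_lM !linearZ /= -scalerAl -scalerAr -!scalerAl mul1r.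
by rewrite scalerA.
Qed.

(** Coassociativity applied to a slice: left slices of Δ(x) form a left
    coideal. *)
Lemma comul_slice (mu : {scalar A}) x :
  Δ (slice_l mu (Δ x)) = \sum_(p <- sweedler x) slice_l mu (Δ p.1) ⊗ p.2.
Proof.
have tri : trilinear_map (fun a b c : A => mu a *: (b ⊗ c)).
  split=> [b c k u v|a]; first by rewrite linearP scalerDl scalerA.
  split=> [c|b] k u v /=.
    by rewrite tensDl tensZl scalerDr !scalerA mulrC.
  by rewrite tensDr tensZr scalerDr !scalerA mulrC.
have sE z : slice_l mu (Δ z) = \sum_(p <- sweedler z) mu p.1 *: p.2.
  rewrite comulE (lin_sum (slice_l_linear mu)).
  by apply: eq_bigr => p _; rewrite slice_lE.
transitivity (\sum_(p <- sweedler x) \sum_(q <- sweedler p.2) mu p.1 *: (q.1 ⊗ q.2)).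
  rewrite sE linear_sum; apply: eq_bigr => p _.
  by rewrite linearZ /= comulE scaler_sumr.
rewrite -(coassoc_sum _ tri); apply: eq_bigr => p _.
by rewrite sE tens_suml; apply: eq_bigr => q _; rewrite tensZl.
Qed.

Section InverseAntipode.
Variable T : A -> A.
Hypotheses (SK : cancel S T) (TK : cancel T S).

Lemma invantipode_linear : linear T.
Proof. by move=> k u v; apply: (can_inj SK); rewrite linearP !TK. Qed.

(** S is anti-multiplicative, so it sends x2 T(x1) to x1 S(x2). *)
Lemma sum_invantipode x : \sum_(p <- sweedler x) p.2 * T p.1 = ε x *: 1.
Proof.
apply: (can_inj SK); rewrite linear_sum linearZ /= antipode1 -sum_antipode_r.
by apply: eq_bigr => p _; rewrite antipodeM TK.
Qed.

(** By coassociativity the sum is S(x1) x2 ⊗ x3. *)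
Lemma comul_antipode_cancel x :
  \sum_(p <- sweedler x) (S p.1 ⊗ 1) * Δ p.2 = 1 ⊗ x.
Proof.
transitivity (\sum_(p <- sweedler x) \sum_(q <- sweedler p.2) (S p.1 * q.1) ⊗ q.2).
  apply: eq_bigr => p _; rewrite comulE mulr_sumr; apply: eq_bigr => q _.
  by rewrite tensM mul1r.
rewrite -(@coassoc_sum _ (fun u v w => (S u * v) ⊗ w)); last by multilinear.
rewrite -[x in RHS]sum_counit_l tens_sumr; apply: eq_bigr => p _.
by rewrite -tens_suml sum_antipode_l tensZr tensZl.
Qed.

(** By coassociativity the sum is x2 T(x1) ⊗ x3; here T has to be the inverse of
    the antipode since the two legs come in the opposite order. *)
Lemma comul_invantipode_cancel x :
  \sum_(p <- sweedler x) Δ p.2 * (T p.1 ⊗ 1) = 1 ⊗ x.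
Proof.
have Tl := invantipode_linear.
transitivity (\sum_(p <- sweedler x) \sum_(q <- sweedler p.2) (q.1 * T p.1) ⊗ q.2).
  apply: eq_bigr => p _; rewrite comulE mulr_suml; apply: eq_bigr => q _.
  by rewrite tensM mulr1.
rewrite -(@coassoc_sum _ (fun u v w => (v * T u) ⊗ w)); last first.
  split=> [b c k u v|a]; last by multilinear.
  by rewrite Tl; move: k (T u) (T v); multilinear.
rewrite -[x in RHS]sum_counit_l tens_sumr; apply: eq_bigr => p _.
by rewrite -tens_suml sum_invantipode tensZr tensZl.
Qed.

(** * The left coideal of a group-like projection *)

Section GroupLike.
Variable P : A.
Hypothesis P_glp : right_group_like_projection P.

Lemma bilinear_antipode_comul : bilinear_map (fun a b : A => (S a ⊗ 1) * Δ b).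
Proof.
split=> [b|a] k u v /=.
  by rewrite linearP tensDl tensZl mulrDl -tensor_scalerAl.
by rewrite linearP mulrDr -tensor_scalerAr.
Qed.

Lemma bilinear_comul_invantipode : bilinear_map (fun a b : A => Δ b * (T a ⊗ 1)).
Proof.
split=> [b|a] k u v /=.
  by rewrite invantipode_linear tensDl tensZl mulrDr -tensor_scalerAr.
by rewrite linearP mulrDl -tensor_scalerAl.
Qed.

(** Apply u ⊗ v |-> (S(u) ⊗ 1) Δ(v) to Δ(x)(1 ⊗ P) = x ⊗ P. *)
Lemma NP_mull x : x \in NP_pred P -> (1 ⊗ x) * Δ P = (S x ⊗ 1) * Δ P.
Proof.
move=> /NP_predP[xP _].
have := congr1 (tlift (fun a b : A => (S a ⊗ 1) * Δ b)) xP.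
rewrite (tlift_tens bilinear_antipode_comul) => <-.
rewrite [Δ x]comulE mulr_suml (lin_sum (tlift_linear bilinear_antipode_comul)).
rewrite -comul_antipode_cancel mulr_suml; apply: eq_bigr => p _.
by rewrite tensM mulr1 (tlift_tens bilinear_antipode_comul) comulM mulrA.
Qed.

(** Apply u ⊗ v |-> Δ(v)(T(u) ⊗ 1) to (1 ⊗ P)Δ(x) = x ⊗ P. *)
Lemma NP_mulr x : x \in NP_pred P -> Δ P * (1 ⊗ x) = Δ P * (T x ⊗ 1).
Proof.
move=> /NP_predP[_ xP].
have := congr1 (tlift (fun a b : A => Δ b * (T a ⊗ 1))) xP.
rewrite (tlift_tens bilinear_comul_invantipode) => <-.
rewrite [Δ x]comulE mulr_sumr (lin_sum (tlift_linear bilinear_comul_invantipode)).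
rewrite -comul_invantipode_cancel mulr_sumr; apply: eq_bigr => p _.
by rewrite tensM mul1r (tlift_tens bilinear_comul_invantipode) comulM mulrA.
Qed.

Lemma slice_l_mulr (mu : {scalar A}) (z : A ⊗ A) (b : A) :
  slice_l mu (z * (1 ⊗ b)) = slice_l mu z * b.
Proof.
have sl := slice_l_linear mu (W := A).
elim/tensor_ind: z => [|x y IHx IHy|v w].
- by rewrite mul0r (lin0 sl) mul0r.
- by rewrite mulrDl !(linD sl) mulrDl -IHx -IHy.
by rewrite tensM mulr1 !slice_lE scalerAl.
Qed.

Lemma slice_l_mull (mu : {scalar A}) (z : A ⊗ A) (b : A) :
  slice_l mu ((1 ⊗ b) * z) = b * slice_l mu z.
Proof.
have sl := slice_l_linear mu (W := A).
elim/tensor_ind: z => [|x y IHx IHy|v w].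
- by rewrite mulr0 (lin0 sl) mulr0.
- by rewrite mulrDr !(linD sl) mulrDr -IHx -IHy.
by rewrite tensM mul1r !slice_lE scalerAr.
Qed.

(** Slicing Δ(P)(1 ⊗ P) = P ⊗ P by the counit gives P = P^2 = ε(P) P. *)
Lemma counit_projection : ε P = 1.
Proof.
have [P0 PP PP1 _] := P_glp.
have := congr1 (slice_l ε) PP1.
rewrite slice_l_mulr.
rewrite counit_l PP slice_lE => /eqP; rewrite -subr_eq0 -[X in X - _]scale1r -scalerBl.
by rewrite scaler_eq0 (negPf P0) orbF subr_eq0 => /eqP.
Qed.

(** The map u ⊗ v |-> Δ(v)(T(u) ⊗ 1) sends (1 ⊗ y)Δ(P) to
    Δ(y)(1 ⊗ P) = y ⊗ P. *)
Lemma NP_left_faithful y : y \in NP_pred P -> (1 ⊗ y) * Δ P = 0 -> y = 0.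
Proof.
move=> /NP_predP[yP _] y0.
have yP0 : y ⊗ P = 0.
  have := congr1 (tlift (fun a b : A => Δ b * (T a ⊗ 1))) y0.
  rewrite (lin0 (tlift_linear bilinear_comul_invantipode)) => <-.
  rewrite -yP -comul_invantipode_cancel [Δ P]comulE !mulr_sumr.
  rewrite (lin_sum (tlift_linear bilinear_comul_invantipode)); apply: eq_bigr => p _.
  by rewrite tensM mul1r (tlift_tens bilinear_comul_invantipode) comulM mulrA.
have := congr1 (slice_r ε) yP0.
rewrite (lin0 (slice_r_linear _)) => <-; rewrite -[LHS]scale1r -counit_projection.
by rewrite slice_rE.
Qed.

(** By [comul_slice], multiplying Δ of a slice of Δ(P) by 1 ⊗ P is the same slice
    of Δ(P)(1 ⊗ P) = P ⊗ P, and likewise on the other side. *)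
Lemma VP_sub_NP (mu : {scalar A}) : slice_l mu (Δ P) \in NP_pred P.
Proof.
have [_ _ PP1 P1P] := P_glp.
have bil : bilinear_map (fun a b : A => slice_l mu (Δ a) ⊗ b).
  split=> [b|a]; last by multilinear.
  move=> k u v; rewrite (linearP comul) slice_l_linear.
  by rewrite tensDl tensZl.
apply/NP_predP; split; rewrite comul_slice.
  have := congr1 (tlift (fun a b : A => slice_l mu (Δ a) ⊗ b)) PP1.
  rewrite (tlift_tens bil) => <-; rewrite [Δ P in RHS]comulE !mulr_suml.
  rewrite (lin_sum (tlift_linear bil)); apply: eq_bigr => p _.
  by rewrite !tensM !mulr1 (tlift_tens bil).
have := congr1 (tlift (fun a b : A => slice_l mu (Δ a) ⊗ b)) P1P.
rewrite (tlift_tens bil) => <-; rewrite [Δ P in RHS]comulE !mulr_sumr.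
rewrite (lin_sum (tlift_linear bil)); apply: eq_bigr => p _.
by rewrite !tensM !mul1r (tlift_tens bil).
Qed.

End GroupLike.
End InverseAntipode.
End Sweedler.

(** * Ideals of finite-dimensional self-injective algebras *)

(** Restriction of scalars. The morphism occurs in the type so that it can
    determine the module structure. *)
Definition restrict (R R' : pzRingType) (h : {rmorphism R -> R'}) (M : lmodType R') : Type := M.

Section Restrict.
Variables (R R' : pzRingType) (h : {rmorphism R -> R'}) (M : lmodType R').

HB.instance Definition _ := GRing.Zmodule.on (restrict h M).

Definition restrict_scale (x : R) (m : restrict h M) : restrict h M := h x *: (m : M).

Lemma restrict_scaleA x y m : restrict_scale x (restrict_scale y m) = restrict_scale (x * y) m.
Proof. by rewrite /restrict_scale rmorphM scalerA. Qed.

Lemma restrict_scale1 : left_id 1 restrict_scale.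
Proof. by move=> m; rewrite /restrict_scale rmorph1 scale1r. Qed.

Lemma restrict_scaleDr : right_distributive restrict_scale +%R.
Proof. by move=> x m m'; exact: scalerDr. Qed.

Lemma restrict_scaleDl m : {morph restrict_scale^~ m : x y / x + y}.
Proof. by move=> x y; rewrite /restrict_scale rmorphD scalerDl. Qed.

HB.instance Definition _ := GRing.Zmodule_isLmodule.Build R (restrict h M)
  restrict_scaleA restrict_scale1 restrict_scaleDr restrict_scaleDl.

End Restrict.

Section SelfInjective.
Variables (K : fieldType) (B : algType K).

(** The row space with its isomorphism [rho] stands for B; [rmul_mx x] is then
    right multiplication by x, acting on row vectors from the right. *)
Section RegularRepresentation.
Variables (n : nat) (rho : {linear B -> 'rV[K]_n}) (sigma : 'rV[K]_n -> B).
Hypotheses (rhoK : cancel rho sigma) (sigmaK : cancel sigma rho).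

Lemma sigma_linear : linear sigma.
Proof. by move=> k u v; apply: (can_inj rhoK); rewrite linearP !sigmaK. Qed.

Definition rmul_row (x : B) (u : 'rV[K]_n) : 'rV[K]_n := rho (sigma u * x).

Lemma rmul_row_linear x : linear (rmul_row x).
Proof.
move=> k u v; rewrite /rmul_row sigma_linear mulrDl linearD -scalerAl.
by rewrite linearZ.
Qed.

Definition rmul_mx (x : B) : 'M[K]_n := lin1_mx (rmul_row x).

Lemma rmul_mxE x u : u *m rmul_mx x = rho (sigma u * x).
Proof. exact: (mul_rV_lin1 (lin_of (rmul_row_linear x))). Qed.

Lemma rmul_mx_linear : linear rmul_mx.
Proof.
move=> k x y; apply/row_matrixP => i; rewrite !rowE rmul_mxE mulmxDr -scalemxAr.
by rewrite !rmul_mxE mulrDr -scalerAr linearP.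
Qed.

Lemma rmul_mx_monoid : monoid_morphism rmul_mx.
Proof.
split=> [|x y]; apply/row_matrixP => i; rewrite !rowE ?rmul_mxE.
  by rewrite mulr1 sigmaK mulmx1.
by rewrite -mulmxE mulmxA !rmul_mxE rhoK mulrA.
Qed.

Definition rmul_mx_rmorphism : {rmorphism B -> 'M[K]_n} :=
  HB.pack rmul_mx (GRing.isLinear.Build _ _ _ _ _ rmul_mx_linear)
   (GRing.isMonoidMorphism.Build _ _ _ rmul_mx_monoid).

(** As a left B-module, the space of K-linear endomorphisms of B with
    (x h)(y) = h(y x) is a sum of copies of the dual of B. In coordinates it is
    the restriction of the regular module of matrices along [rmul_mx], and
    [rmul_mx] embeds B in it; injectivity of B splits this embedding. *)
Lemma self_injective_retraction : injective_module (GRing.regular B) ->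
  exists g : 'M[K]_n -> B, [/\ linear g, forall x, g (rmul_mx x) = x
    & forall x M, g (rmul_mx x *m M) = x * g M].
Proof.
move=> inj; pose Y : lmodType B := restrict rmul_mx_rmorphism (GRing.regular 'M[K]_n).
have i_lin : linear (rmul_mx : GRing.regular B -> Y).
  move=> x y z; rewrite -[LHS]/(rmul_mx (x * y + z)) (linD rmul_mx_linear).
  by rewrite rmul_mx_monoid.2.
have [|g gE] := inj _ Y (lin_of i_lin) idfun.
  move=> x y /= /(congr1 (mulmx (rho 1))); rewrite !rmul_mxE rhoK !mul1r.
  exact: (can_inj rhoK).
have gM x M : g (rmul_mx x *m M) = x * g M by exact: (linearZ_LR g x M).
exists g; split=> // k M N; rewrite -[in RHS](mul1r (g M)) scalerAl -gM -(linearD g).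
congr (g (_ + N)); rewrite (linZ rmul_mx_linear) -scalemxAl rmul_mx_monoid.1.
by rewrite mul1mx.
Qed.

End RegularRepresentation.

(** Let p project B onto V and let g be the retraction of
    [self_injective_retraction]; then Phi(M) = g(M) - p(g(M)) vanishes on
    multiples of M by elements of V. Restricted to the matrices with one nonzero
    column l, each coordinate of Phi is a functional on the dual of B and so is
    evaluation at some nu in B. That Phi vanishes on those multiples says nu v = 0
    for all v in V. Hence nu = 0, so Phi = 0 and 1 = g(1) = p(1) lies in V. *)
Lemma self_injective_right_ideal (V : set B) :
  finite_dimensional B -> injective_module (GRing.regular B) ->
  subspace V -> (forall v x, V v -> V (v * x)) ->
  (forall y, (forall v, V v -> y * v = 0) -> y = 0) -> V 1.
Proof.
move=> [n [[rho0 rho_lin [sigma rhoK sigmaK]]]] inj Vsub Vr Vann.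
pose rho := lin_of rho_lin.
have [g [g_lin gR gM]] := @self_injective_retraction n rho sigma rhoK sigmaK inj.
have [p [pV pE]] := subspace_projection Vsub.
pose Phi (M : 'M[K]_n) := rho (g M - p (g M)).
have Phi_lin : linear Phi.
  by move=> k M N; rewrite /Phi g_lin linearP opprD addrACA -scalerBr linearP.
have PhiV v M : V v -> Phi (rmul_mx rho sigma v *m M) = 0.
  by move=> Vv; rewrite /Phi gM pE ?subrr ?linear0 //; exact: Vr.
have Phi0 k l : Phi (delta_mx k l) = 0.
  apply/rowP => j; rewrite [RHS]mxE.
  pose nu : 'rV[K]_n := \row_k Phi (delta_mx k l) 0 j.
  suff : nu = 0 by move/rowP => /(_ k); rewrite !mxE.
  rewrite -[nu]sigmaK [sigma nu]Vann ?(lin0 rho_lin) // => v Vv.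
  apply: (can_inj rhoK); rewrite (lin0 rho_lin) -[LHS]/(rho _).
  rewrite -(@rmul_mxE n rho sigma rhoK sigmaK); apply/rowP => m; rewrite !mxE.
  transitivity (Phi (rmul_mx rho sigma v *m delta_mx m l) 0 j).
    2: by rewrite PhiV // mxE.
  have -> : rmul_mx rho sigma v *m delta_mx m l
      = \sum_k0 rmul_mx rho sigma v k0 m *: delta_mx k0 l.
    apply/matrixP => r s; rewrite mxE summxE.
    rewrite (bigD1 m) //= [X in _ + X]big1 => [|t tm]; last first.
      by rewrite [X in _ * X]mxE (negPf tm) mulr0.
    rewrite [RHS](bigD1 r) //= [X in _ = _ + X]big1 => [|t tr]; last first.
      by rewrite !mxE eq_sym (negPf tr) mulr0.
    by rewrite !mxE !eqxx.
  rewrite (lin_sum Phi_lin) summxE; apply: eq_bigr => k0 _.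
  by rewrite mxE (linZ Phi_lin) [in RHS]mxE mulrC.
have : Phi (rmul_mx rho sigma 1) = 0.
  rewrite [rmul_mx _ _ _]matrix_sum_delta (lin_sum Phi_lin) big1 // => r _.
  rewrite (lin_sum Phi_lin) big1 // => s _.
  by rewrite (linZ Phi_lin) Phi0 scaler0.
rewrite /Phi gR -(linear0 rho) => /(can_inj rhoK)/eqP.
by rewrite subr_eq0 => /eqP ->.
Qed.

End SelfInjective.

(** * Comparing the coideal with the coideal subalgebra *)

Section Characterisation.
Variables (K : fieldType) (A : hopfAlgType K).
Local Notation Δ := (comul : A -> A ⊗ A).
Local Notation S := (antipode : A -> A).
Local Notation ε := (counit : A -> K).
Variable T : A -> A.
Hypotheses (SK : cancel S T) (TK : cancel T S).
Variable P : A.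
Hypothesis P_glp : right_group_like_projection P.
Local Notation N := (NP_alg P).

Lemma slice_l_sum (mu : {scalar A}) n (a b : 'I_n -> A) :
  slice_l mu (\sum_i a i ⊗ b i) = \sum_i mu (a i) *: b i.
Proof.
by rewrite (lin_sum (slice_l_linear mu)); apply: eq_bigr => i _; rewrite slice_lE.
Qed.

(** The right legs of a minimal expression of Δ(P) are slices of Δ(P), hence lie
    in V and a fortiori in N. *)
Lemma coideal_basis : exists n (a : 'I_n -> A) (b : 'I_n -> N) (nu : 'I_n -> {scalar A}),
  [/\ Δ P = \sum_i a i ⊗ (b i : A), forall i, VP P (b i)
    & forall i j, nu i (b j : A) = (i == j)%:R].
Proof.
have [n [a [b [mu [nu [PE muE nuE]]]]]] := tensor_biorthogonal (Δ P).
have bE j : b j = slice_l (mu j) (Δ P).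
  rewrite PE slice_l_sum (bigD1 j) //= muE eqxx scale1r big1 ?addr0 // => i ij.
  by rewrite muE eq_sym (negPf ij) scale0r.
have bN j : b j \in NP_pred P by rewrite bE; exact: VP_sub_NP.
by exists n, a, (fun j => NPAlg (bN j)), nu; split=> // j; exists (mu j); exact: bE.
Qed.

Lemma NP_val_mem (x : N) : NP P (x : A).
Proof. by apply: set_mem; exact: (valP x). Qed.

Lemma NP_val_inj : injective (@NP_val K A P).
Proof. exact: val_inj. Qed.

Lemma NP_valD (x y : N) : NP_val (x + y) = NP_val x + NP_val y.
Proof. exact: (rmorphD (val : N -> A)). Qed.

Lemma NP_valM (x y : N) : NP_val (x * y) = NP_val x * NP_val y.
Proof. exact: (rmorphM (val : N -> A)). Qed.

Lemma NP_valZ k (x : N) : NP_val (k *: x) = k *: NP_val x.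
Proof. exact: (linearZ_LR (val : N -> A)). Qed.

Lemma NP_val1 : NP_val (1 : N) = 1.
Proof. exact: (rmorph1 (val : N -> A)). Qed.

Lemma NP_val_sum I (r : seq I) (F : I -> N) :
  NP_val (\sum_(i <- r) F i) = \sum_(i <- r) NP_val (F i).
Proof. exact: (raddf_sum (val : N -> A)). Qed.

Lemma VP_NP_finite_dimensional : VP P = NP P -> finite_dimensional N.
Proof.
move=> VN; have [n [a [b [nu [PE _ nuE]]]]] := coideal_basis.
exists n; constructor; exists (fun x : N => \row_j nu j (x : A)).
  by move=> k x y; apply/rowP => j; rewrite !mxE NP_valD NP_valZ linearP.
have nu_sum (c : 'I_n -> K) j : nu j (\sum_i c i *: (b i : A)) = c j.
  rewrite linear_sum (bigD1 j) //= linearZ /= nuE eqxx mulr1 big1 ?addr0 // => i ij.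
  by rewrite linearZ /= nuE eq_sym (negPf ij) mulr0.
exists (fun c : 'rV_n => \sum_j c 0 j *: b j) => [x|c].
  apply: NP_val_inj; rewrite NP_val_sum.
  have : VP P x by rewrite VN; exact: NP_val_mem.
  move=> [mu xE]; rewrite PE slice_l_sum in xE; rewrite [RHS]xE.
  by apply: eq_bigr => j _; rewrite mxE NP_valZ xE nu_sum.
apply/rowP => j; rewrite mxE NP_val_sum -[RHS](nu_sum (fun i => c 0 i)).
by congr (nu j _); apply: eq_bigr => i _; rewrite NP_valZ.
Qed.

(** Let 1 = mu(P1) P2, so that Phi(c) = mu(c P1) P2 satisfies Phi(1) = 1 and, by
    [NP_mull], Phi(c S(x)) = x Phi(c). Let r be a K-linear retraction of i. The
    extension of f is Phi o h, where h(y) = S(f(r(P2 y))) S^2(P1) is the average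
    over P. By [NP_mulr], h(x y) = h(y) S(x), which makes Phi o h N-linear; and
    on the image of i one gets
    h(i x) = S(f x) S(S(P1) P2) = ε(P) S(f x) = S(f x). *)
Lemma VP_NP_injective : VP P = NP P -> injective_module (GRing.regular N).
Proof.
move=> VN X Y i f i_inj.
have [n [a [b [nu [PE _ _]]]]] := coideal_basis.
have [mu mu1] : VP P 1 by rewrite VN -NP_val1; exact: NP_val_mem.
pose XK : lmodType K := restrict (in_alg N) X.
pose YK : lmodType K := restrict (in_alg N) Y.
have algZ k (x : N) : k *: x = k%:A * x by rewrite mulr_algl.
have iK_lin : linear (i : XK -> YK) by move=> k x y; exact: linearP.
have [r rK] := linear_retraction (i := lin_of iK_lin) i_inj.
have val_lin : linear (val : N -> A) by move=> k x y; exact: linearP.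
have [pi piK0] := linear_retraction (i := lin_of val_lin) val_inj.
have piK (x : N) : pi (NP_val x) = x := piK0 x.
pose Phi (c : A) : N := \sum_j mu (c * a j) *: b j.
have PhiE c : NP_val (Phi c) = slice_l mu ((c ⊗ 1) * Δ P).
  rewrite PE mulr_sumr NP_val_sum (lin_sum (slice_l_linear mu)); apply: eq_bigr => j _.
  by rewrite tensM mul1r slice_lE NP_valZ.
have PhiD c d : Phi (c + d) = Phi c + Phi d.
  rewrite /Phi -big_split; apply: eq_bigr => j _.
  by rewrite mulrDl linearD scalerDl.
have PhiM c (x : N) : Phi (c * S x) = x * Phi c.
  apply: NP_val_inj; rewrite NP_valM !PhiE.
  have -> : (c * S x) ⊗ 1 = (c ⊗ 1) * (S x ⊗ 1) :> A ⊗ A by rewrite tensM mulr1.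
  rewrite -mulrA -(NP_mull (valP x)) mulrA -slice_l_mull mulrA.
  by rewrite !tensM !mulr1 !mul1r.
have Phi1 : Phi 1 = 1.
  by apply: NP_val_inj; rewrite PhiE tens1 mul1r -mu1 NP_val1.
pose phi (u : Y) : N := f (r u).
have phi_lin k (u w : Y) : phi (k%:A *: u + w) = k *: phi u + phi w.
  rewrite /phi; have -> : r (k%:A *: u + w) = k%:A *: (r u : X) + r w := linearP r k u w.
  by rewrite linearP algZ.
have phiD (u w : Y) : phi (u + w) = phi u + phi w.
  by have := phi_lin 1 u w; rewrite !scale1r.
(* F has to be bilinear on A, so that it can be applied to the tensor identity
   [NP_mulr]; pi extends the action of N on Y to A for that purpose. *)
pose F (y : Y) (u v : A) : A := S (NP_val (phi (pi v *: y))) * S (S u).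
have F_bil y : bilinear_map (F y).
  split=> [v|u] k s t; rewrite /F.
    by rewrite !linearD !linearZ_LR mulrDr scalerAr.
  rewrite linearP scalerDl algZ -scalerA phi_lin NP_valD NP_valZ.
  by rewrite linearD linearZ_LR mulrDl scalerAl.
pose h y := \sum_j F y (a j) (NP_val (b j)).
have hD y z : h (y + z) = h y + h z.
  rewrite /h -big_split; apply: eq_bigr => j _ /=.
  by rewrite /F scalerDr phiD NP_valD linearD mulrDl.
have hM y (x : N) : h (x *: y) = h y * S x.
  have := congr1 (tlift (F y)) (NP_mulr SK TK (valP x)).
  rewrite PE !mulr_suml !(lin_sum (tlift_linear (F_bil y))) => e.
  rewrite /h; etransitivity; last (etransitivity; first exact: e).
    apply: eq_bigr => j _; rewrite tensM mulr1 (tlift_tens (F_bil y)).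
    by rewrite /F -[_ * \val x]NP_valM !{}piK scalerA.
  apply: eq_bigr => j _; rewrite tensM mulr1 (tlift_tens (F_bil y)).
  by rewrite /F !antipodeM TK mulrA.
have hi x : h (i x) = S (NP_val (f x)).
  transitivity (S (NP_val (f x)) * S (ε P *: 1)); last first.
    by rewrite (counit_projection P_glp) scale1r antipode1 mulr1.
  have bil : bilinear_map (fun u v : A => S u * v) by multilinear.
  rewrite -sum_antipode_l (sum_sweedlerE bil PE).
  rewrite linear_sum mulr_sumr; apply: eq_bigr => j _.
  by rewrite /F piK /phi -linearZ_LR rK linearZ_LR NP_valM !antipodeM mulrA.
have g_lin : linear (fun y => Phi (h y) : GRing.regular N).
  by move=> x y z; rewrite hD hM PhiD PhiM.
exists (lin_of g_lin) => x /=.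
by rewrite hi -[S _]mul1r PhiM Phi1 mulr1.
Qed.

Lemma VP_subspace : subspace (fun x : N => VP P x).
Proof.
split.
  have sc : scalar (fun _ : A => 0 : K) by move=> s u v; rewrite mulr0 addr0.
  exists (scalar_of sc); rewrite -[LHS]/(NP_val 0).
  elim/tensor_ind: (Δ P) => [|z w IHz IHw|u v].
  - by rewrite (lin0 (slice_l_linear _)).
  - by rewrite (linD (slice_l_linear _)) -IHz -IHw addr0.
  by rewrite slice_lE scale0r.
move=> k x y [mu xE] [nu yE].
have sc : scalar (fun c => k * mu c + nu c).
  by move=> s u v; rewrite !linearP /= mulrDr addrACA mulrCA -mulrDr.
exists (scalar_of sc); rewrite NP_valD NP_valZ xE yE.
elim/tensor_ind: (Δ P) => [|z w IHz IHw|u v].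
- by rewrite !(lin0 (slice_l_linear _)) scaler0 addr0.
- by rewrite !(linD (slice_l_linear _)) scalerDr addrACA IHz IHw.
by rewrite !slice_lE scalerA -scalerDl.
Qed.

(** [NP_mulr] moves the factor x to the left leg of Δ(P), where the functional
    absorbs it. *)
Lemma VP_right_ideal (v x : N) : VP P v -> VP P (v * x : N).
Proof.
move=> [mu vE]; have sc : scalar (fun c => mu (c * T (val x))).
  by move=> s u w; rewrite mulrDl -scalerAl linearP.
exists (scalar_of sc); rewrite NP_valM vE -slice_l_mulr (NP_mulr SK TK (valP x)).
elim/tensor_ind: (Δ P) => [|z w IHz IHw|u w].
- by rewrite mul0r !(lin0 (slice_l_linear _)).
- by rewrite mulrDl !(linD (slice_l_linear _)) IHz IHw.
by rewrite tensM mulr1 !slice_lE.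
Qed.

Lemma VP_left_annihilator (y : N) : (forall v : N, VP P v -> y * v = 0) -> y = 0.
Proof.
move=> y0; have [n [a [b [nu [PE bV _]]]]] := coideal_basis.
apply: NP_val_inj; rewrite (NP_left_faithful SK TK P_glp (valP y)) //.
rewrite PE mulr_sumr big1 // => i _.
rewrite tensM mul1r -[_ * _]NP_valM y0; last exact: bV.
exact: (lin0 ((tens_bilinear A A).2 (a i))).
Qed.

Lemma quasi_frobenius_VP_NP : quasi_frobenius N -> VP P = NP P.
Proof.
move=> [fd inj].
have V1 := self_injective_right_ideal fd inj VP_subspace VP_right_ideal VP_left_annihilator.
rewrite predeqE => x; split=> [[mu ->]|xN].
  by apply: set_mem; exact: VP_sub_NP.
have xN' : x \in NP_pred P by exact: mem_set.
by have := VP_right_ideal (NPAlg xN') V1; rewrite mul1r.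
Qed.

End Characterisation.

Theorem theorem3p17 (K : fieldType) (A : hopfAlgType K)
    (antipode_bij : bijective (antipode : A -> A))
    (P : A) (hP : right_group_like_projection P) :
  VP P = NP P <-> quasi_frobenius (NP_alg P).
Proof.
case: antipode_bij => T SK TK; split=> [VN|]; last exact: quasi_frobenius_VP_NP.
by split; [exact: VP_NP_finite_dimensional|exact: (VP_NP_injective SK TK)].
Qed.
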